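(* Let $\tau>0$, $\xi\in[t_0,t_0+\tau]$, $\eta\in\mathbb R^m$, and let $y(t)\equiv y(t,\xi,\eta,\phi;t_0)$ be the solution of $$\dot y(t)=f(y(t),y(t-\tau)),\quad t\in[t_0,t_0+\tau],\qquad y(\xi)=\eta,\qquad y(t)=\phi(t),\quad t\in[t_0-\tau,t_0).$$ With $\Phi$ and $\Psi$ as defined in the context, for any $\hat t\in(\xi-\tau,t_0)$ one has $$\Psi(t,\hat t\,;t_0)=\Phi(t,\hat t+\tau;t_0)\,F_2(y(\hat t+\tau),y(\hat t\,)),\qquad t\in[\hat t+\tau,t_0+\tau].$$
   Context: $f:\mathbb R^m\times\mathbb R^m\to\mathbb R^m$, $(z,w)\mapsto f(z,w)$, and $\phi:[t_0-\tau,t_0]\to\mathbb R^m$ are assumed suitably regular (as smooth as needed); $F_1(z,w)=\frac{\partial}{\partial z}f(z,w)$, $F_2(z,w)=\frac{\partial}{\partial w}f(z,w)$. The solution is taken to be defined on all of $[t_0,t_0+\tau]$, and $y(t-\tau)=\phi(t-\tau)$ for $t\in[t_0,t_0+\tau]$. For $\theta\in[t_0,t_0+\tau]$, $\Phi(t,\theta;t_0)\in\mathbb R^{m\times m}$ is the solution of $\dot\Phi(t,\theta;t_0)=F_1(y(t),y(t-\tau))\Phi(t,\theta;t_0)$, $t\in[t_0,t_0+\tau]$, $\Phi(\theta,\theta;t_0)=I$, and $\Phi(t,\theta;t_0)=O$ for $t\in[t_0-\tau,t_0)$. $\Psi(t,\hat t\,;t_0)\in\mathbb R^{m\times m}$ (the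 functional derivative of $y(t)$ with respect to $\phi(\hat t\,)$) satisfies $$\dot\Psi(t,\hat t\,;t_0)=F_1(y(t),y(t-\tau))\Psi(t,\hat t\,;t_0),\quad t\in(\hat t+\tau,t_0+\tau],\qquad \Psi(\hat t+\tau,\hat t\,;t_0)=F_2(y(\hat t+\tau),y(\hat t\,)),$$ and $\Psi(t,\hat t\,;t_0)=\delta_{\hat t}(t)I$ for $t\in[t_0-\tau,\hat t+\tau)$, with $\delta_{\hat t}$ the Dirac delta centered at $\hat t$. The dot denotes differentiation in $t$, and $\Psi$ is understood to be continuous in $t$ on $[\hat t+\tau,t_0+\tau]$. *)

(* Defs.v *)
From HB Require Import structures.
From mathcomp Require Import all_boot all_order all_algebra.
From mathcomp Require Import all_classical all_reals all_analysis.

Set Implicit Arguments.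
Unset Strict Implicit.
Unset Printing Implicit Defensive.

Import Order.TTheory GRing.Theory Num.Theory.
Import numFieldNormedType.Exports.

Local Open Scope classical_set_scope.
Local Open Scope ring_scope.

(* Derivative relative to a set [A] : two-sided in the interior, one-sided at
   the end points of an interval.  The solution may jump at [t0], so no
   two-sided derivative is available there. *)
Definition has_derivative_within (R : realType) (V : normedModType R)
    (A : set R) (u : R -> V) (t : R) (l : V) : Prop :=
  (s - t)^-1 *: (u s - u t) @[s --> within A t^'] --> l.

(* Jacobian matrices with respect to the first and the second argument, acting
   on column vectors: row index = component of [f], column index = variable. *)
Definition F1 (R : realType) (m : nat) (f : 'cV[R]_m -> 'cV[R]_m -> 'cV[R]_m)
    (z w : 'cV[R]_m) : 'M[R]_m :=
  \matrix_(i, j) ('D_(delta_mx j 0) (fun z' => f z' w) z) i 0.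

Definition F2 (R : realType) (m : nat) (f : 'cV[R]_m -> 'cV[R]_m -> 'cV[R]_m)
    (z w : 'cV[R]_m) : 'M[R]_m :=
  \matrix_(i, j) ('D_(delta_mx j 0) (fun w' => f z w') w) i 0.

Definition C1 (R : realType) (m : nat)
    (f : 'cV[R]_m -> 'cV[R]_m -> 'cV[R]_m) : Prop :=
  [/\ forall p : 'cV[R]_m * 'cV[R]_m,
        differentiable (fun q : 'cV[R]_m * 'cV[R]_m => f q.1 q.2) p,
      continuous (fun p : 'cV[R]_m * 'cV[R]_m => F1 f p.1 p.2)
    & continuous (fun p : 'cV[R]_m * 'cV[R]_m => F2 f p.1 p.2)].

(* On [t0, t0 + tau] the delayed value y(t - tau) is phi(t - tau), including at
   t = t0 + tau, where it is phi(t0) and not y(t0): the two may differ. *)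
Definition is_solution (R : realType) (m : nat)
    (f : 'cV[R]_m -> 'cV[R]_m -> 'cV[R]_m) (tau t0 xi : R) (eta : 'cV[R]_m)
    (phi y : R -> 'cV[R]_m) : Prop :=
  [/\ forall t, t \in `[t0, t0 + tau] ->
        has_derivative_within `[t0, t0 + tau] y t (f (y t) (phi (t - tau))),
      y xi = eta
    & forall t, t \in `[t0 - tau, t0[ -> y t = phi t].

Definition is_Phi (R : realType) (m : nat)
    (f : 'cV[R]_m -> 'cV[R]_m -> 'cV[R]_m) (tau t0 : R)
    (phi y : R -> 'cV[R]_m) (theta : R) (X : R -> 'M[R]_m) : Prop :=
  [/\ forall t, t \in `[t0, t0 + tau] ->
        has_derivative_within `[t0, t0 + tau] X t
          (F1 f (y t) (phi (t - tau)) *m X t),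
      X theta = 1%:M
    & forall t, t \in `[t0 - tau, t0[ -> X t = 0].

(* A matrix-valued generalized function of time that is a matrix of signed
   measures on an initial interval ([gen_part]) and an ordinary function
   afterwards ([fun_part]).  Where the initial interval ends is not recorded
   here; it is fixed by the conditions imposed on the two parts. *)
Record gen_mx_fun (R : realType) (m : nat) := GenMxFun {
  gen_part : 'I_m -> 'I_m -> {charge set (measurableTypeR R) -> \bar R};
  fun_part :> R -> 'M[R]_m
}.

(* The last clause is Psi(t) = delta_that(t) I for t in [t0 - tau, that + tau[:
   on Borel subsets of that interval the (i, j) entry is the Dirac measure at
   [that] if i = j, and the zero measure otherwise. *)
Definition is_Psi (R : realType) (m : nat)
    (f : 'cV[R]_m -> 'cV[R]_m -> 'cV[R]_m) (tau t0 : R)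
    (phi y : R -> 'cV[R]_m) (that : R) (X : gen_mx_fun R m) : Prop :=
  [/\ forall t, t \in `]that + tau, t0 + tau] ->
        has_derivative_within `[that + tau, t0 + tau] X t
          (F1 f (y t) (phi (t - tau)) *m X t),
      X (that + tau) = F2 f (y (that + tau)) (y that),
      {within `[that + tau, t0 + tau], continuous X}
    & forall (i j : 'I_m) (B : set (measurableTypeR R)),
        measurable B -> B `<=` `[t0 - tau, that + tau[ ->
        gen_part X i j B = if i == j then \d_that B else 0%E].

(* Main.v *)
Require Import Defs.
From mathcomp Require Import all_boot all_order all_algebra.
From mathcomp Require Import all_classical all_reals all_analysis.
From mathcomp Require Import ring lra.
Import Order.TTheory GRing.Theory Num.Theory.
Import numFieldNormedType.Exports.
Local Open Scope classical_set_scope.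
Local Open Scope ring_scope.

(** The difference [X = Psi - Phi C], with [C = F2 (y (that + tau)) (y that)],
    solves the linear equation [X' = A X] with
    [A t = F1 (y t) (phi (t - tau))] for [that + tau < t <= t0 + tau], and it
    vanishes at [that + tau] because [Phi (that + tau) (that + tau)] is the
    identity and [Psi] starts from [C].  Hence the identity is the uniqueness of
    the solution of a linear initial value problem (lemma [linear_ode_zero]).

    Uniqueness follows from an energy estimate.  The coefficient [A] is
    continuous on a compact interval ([variational_coef_continuous]), so its
    entries are bounded by some [K], and the squared Frobenius norm [g] of [X]
    satisfies [g' <= 2 m K g] ([quadratic_form_bound]).  Therefore
    [g t * exp (- 2 m K t)] is nonincreasing; it is nonnegative and starts at
    0, so it vanishes.  This needs the differential equation only in the open
    interval, together with continuity up to the end points, which is what makes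
    the initial time harmless: there [Psi] is only known to be continuous. *)

(** * Derivatives relative to a set *)

Lemma has_derivative_within_cvg {R : realType} {V : normedModType R}
    {A : set R} {u : R -> V} {t : R} {l : V} :
  has_derivative_within A u t l -> u s @[s --> within A (nbhs t)] --> u t.
Proof.
move=> ul.
(* The difference quotient converges and is multiplied by [s - t] -> 0. *)
have punct : u s @[s --> within A t^'] --> u t.
  have tt : within A t^' --> t.
    by apply: cvg_trans (@nbhs_dnbhs _ t); exact: cvg_within.
  have st : (s - t) @[s --> within A t^'] --> (0 : R).
    by rewrite -[X in _ --> X](subrr t); apply: cvgB; [exact: tt|exact: cvg_cst].
  rewrite -[u t]addr0 -[X in _ + X](scale0r l).
  apply: cvg_trans (cvgD (cvg_cst (u t)) (cvgZ st ul)).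
  apply: near_eq_cvg; rewrite !near_withinE; near=> s => st0 As /=.
  rewrite -[LHS]/(u t + (s - t) *: ((s - t)^-1 *: (u s - u t))).
  by rewrite scalerA divff ?subr_eq0 // scale1r addrC subrK.
move=> U Ut; have {}punct : \forall s \near within A t^', U (u s) := punct U Ut.
rewrite !near_withinE in punct.
change (\forall s \near within A (nbhs t), U (u s)); rewrite near_withinE.
apply: filterS punct => s Us As.
by have [->|st] := eqVneq s t; [exact: nbhs_singleton|exact: Us].
Unshelve. all: by end_near. Qed.

Lemma has_derivative_within_is_derive {R : realType} {V : normedModType R}
    {A : set R} {u : R -> V} {t : R} {l : V} :
  nbhs t A -> has_derivative_within A u t l -> is_derive t 1 u l.
Proof.
move=> tA ul.
have lim : h^-1 *: ((u \o shift t) (h *: 1) - u t) @[h --> (0 : R)^'] --> l.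
  have shiftA : (h + t) @[h --> (0 : R)^'] `=>` within A t^'.
    move=> U; rewrite /= !nbhs_simpl.
    change ((\forall s \near within A t^', U s) -> \forall h \near (0 : R)^', U (h + t)).
    rewrite !near_withinE => AU.
    suff: \forall h \near (0 : R), A (h + t) /\ (h + t != t -> A (h + t) -> U (h + t)).
      by apply: filterS => h [Ah Uh] h0; apply: Uh => //; rewrite -subr_eq0 addrK.
    have : (h + t) @[h --> (0 : R)] --> t.
      by rewrite -[X in _ --> X]add0r; apply: cvgD; [exact: cvg_id|exact: cvg_cst].
    move/(_ [set s | A s /\ (s != t -> A s -> U s)]); apply.
    exact: filterI.
  have := cvg_comp _ _ shiftA ul.
  by apply: cvg_trans; apply: near_eq_cvg; near=> h; rewrite /= addrK /GRing.scale /= mulr1.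
by apply: DeriveDef; [apply/cvg_ex; exists l|exact: cvg_lim lim].
Unshelve. all: by end_near. Qed.

Lemma has_derivative_within_coord {R : realType} {m n : nat}
    {A : set R} {u : R -> 'M[R]_(m, n)} {t : R} {l : 'M[R]_(m, n)} i j :
  has_derivative_within A u t l ->
  has_derivative_within A (fun s => u s i j) t (l i j).
Proof.
move=> ul; have := cvg_comp _ _ ul (@coord_continuous _ _ _ i j l).
by apply: cvg_trans; apply: near_eq_cvg; near=> s; rewrite /= !mxE.
Unshelve. all: by end_near. Qed.

Lemma has_derivative_within_sub {R : realType} {V : normedModType R}
    {A B : set R} {u : R -> V} {t : R} {l : V} :
  B `<=` A -> has_derivative_within A u t l -> has_derivative_within B u t l.
Proof.
move=> BA; apply: cvg_trans; apply: cvg_app; apply: within_subset BA.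
Qed.

(** * Uniqueness for linear differential equations *)

(** Each term obeys [2 a x y <= K (x^2 + y^2)], by
    [2 K (x^2 + y^2) - 4 a x y = (K - a) (x + y)^2 + (K + a) (x - y)^2].  In
    the triple sum over [i], [j], [k] each of the two squares is counted [m]
    times, whence the factor [2 m K]. *)
Lemma quadratic_form_bound (R : realDomainType) (m p : nat) (A : 'M[R]_m)
    (X : 'M[R]_(m, p)) (K : R) :
  (forall i k, `|A i k| <= K) ->
  \sum_i \sum_j 2 * (X i j * (A *m X) i j) <=
    2 * m%:R * K * \sum_i \sum_j X i j ^+ 2.
Proof.
move=> AK.
have term (a x y : R) : `|a| <= K -> 2 * (x * (a * y)) <= K * x ^+ 2 + K * y ^+ 2.
  rewrite ler_norml => /andP[Ka aK].
  have P : 0 <= (K - a) * (x + y) ^+ 2 by rewrite mulr_ge0 ?sqr_ge0 // subr_ge0.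
  have Q : 0 <= (K + a) * (x - y) ^+ 2.
    by rewrite mulr_ge0 ?sqr_ge0 // -lerBlDr sub0r lerNl.
  nra.
apply: (@le_trans _ _ (\sum_i \sum_j \sum_k (K * X i j ^+ 2 + K * X k j ^+ 2))).
  apply: ler_sum => i _; apply: ler_sum => j _.
  rewrite mxE !mulr_sumr; apply: ler_sum => k _; exact: term.
have -> : \sum_i \sum_j \sum_k (K * X i j ^+ 2 + K * X k j ^+ 2) =
    \sum_(i < m) (\sum_j m%:R * K * X i j ^+ 2 + \sum_j \sum_k K * X k j ^+ 2).
  apply: eq_bigr => i _; rewrite -big_split; apply: eq_bigr => j _ /=.
  by rewrite big_split /= sumr_const card_ord -(mulr_natl (K * _)) (mulrA _ K).
rewrite big_split /= sumr_const card_ord.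
rewrite [X in _ + X *+ m]exchange_big /=.
have -> : \sum_(k < m) \sum_(j < p) K * X k j ^+ 2 = K * \sum_i \sum_j X i j ^+ 2.
  by rewrite mulr_sumr; apply: eq_bigr => i _; rewrite mulr_sumr.
have -> : \sum_(k < m) \sum_(j < p) m%:R * K * X k j ^+ 2 =
    m%:R * K * \sum_i \sum_j X i j ^+ 2.
  by rewrite mulr_sumr; apply: eq_bigr => i _; rewrite mulr_sumr.
rewrite -(mulr_natl (K * _)); set S := \sum_i _; set M := m%:R.
suff -> : M * K * S + M * (K * S) = 2 * M * K * S by [].
by ring.
Qed.

(** Derivative and continuity are stated entrywise because the energy is a sum of
    squares of entries.  The equation is assumed only in the open interval, so
    that one-sided derivatives at the end points do not enter. *)
Lemma linear_ode_zero (R : realType) (m p : nat) (a b : R)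
    (A : R -> 'M[R]_m) (X : R -> 'M[R]_(m, p)) :
  {within `[a, b], continuous A} ->
  (forall t, t \in `]a, b[ -> forall i j,
     is_derive t 1 (fun s => X s i j) ((A t *m X t) i j)) ->
  (forall i j, {within `[a, b], continuous (fun s => X s i j)}) ->
  X a = 0 ->
  forall t, t \in `[a, b] -> X t = 0.
Proof.
move=> Ac dX Xc Xa t tab.
have ab : a <= b by move: tab; rewrite in_itv /= => /andP[]; exact: le_trans.
have [K AK] : exists K, forall s, s \in `[a, b] -> forall i k, `|A s i k| <= K.
  have nAc : {within `[a, b], continuous (fun s => `|A s|)}.
    by move=> s; apply: cvg_norm; exact: Ac.
  have [c _ cmax] := EVT_max ab nAc.
  exists `|A c| => s /cmax sc i k; apply: le_trans sc.
  rewrite {2}/Num.norm /= mx_normrE.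
  exact: (le_bigmax _ (fun ij => `|A s ij.1 ij.2|) (i, k)).
pose C := 2 * m%:R * K.
pose g s := \sum_i \sum_j X s i j ^+ 2.
have g_ge0 s : 0 <= g s.
  by apply: sumr_ge0 => i _; apply: sumr_ge0 => j _; exact: sqr_ge0.
have gc : {within `[a, b], continuous g}.
  move=> s; apply: cvg_big => [|i _]; first exact: add_continuous.
  apply: cvg_big => [|j _]; first exact: add_continuous.
  by under eq_cvg do rewrite expr2; rewrite expr2; apply: cvgM; exact: Xc.
have dg s : s \in `]a, b[ ->
    is_derive s 1 g (\sum_i \sum_j 2 * (X s i j * (A s *m X s) i j)).
  move=> sab; have -> : g = \sum_i \sum_j (fun s => X s i j) ^+ 2.
    apply/funext => r; rewrite fct_sumE; apply: eq_bigr => i _.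
    by rewrite fct_sumE.
  apply: is_derive_sum => i; apply: is_derive_sum => j.
  have dXij := dX _ sab i j.
  by apply: is_derive_eq; rewrite /= expr1 /GRing.scale /= mulrA.
pose e (s : R) := expR (- C * s).
have de (s : R) : is_derive s 1 e (- C * e s).
  have dl : is_derive s 1 (fun r => - C * r) (- C).
    by apply: is_derive_eq (is_deriveZ (- C) (@is_derive_id R R s 1)) _;
      rewrite /GRing.scale /= mulr1.
  by apply: is_derive_eq (is_derive1_comp (is_derive_expR _) dl) _; rewrite mulrC.
(* Integrating factor for [g' <= C g]. *)
pose h s := g s * e s.
have dh s : s \in `]a, b[ -> is_derive s 1 h
    ((\sum_i \sum_j 2 * (X s i j * (A s *m X s) i j) - C * g s) * e s).
  move=> /dg dgs; apply: is_derive_eq (is_deriveM dgs (de s)) _.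
  by rewrite /GRing.scale /=; ring.
have hc : {within `[a, b], continuous h}.
  move=> s; apply: cvgM; first exact: gc.
  apply: continuous_subspaceT => {}s; apply: differentiable_continuous.
  by apply/derivable1_diffP; exact: ex_derive.
have ht0 : h t <= 0.
  have -> : 0 = h a.
    rewrite /h /g Xa big1 ?mul0r // => i _; apply: big1 => j _.
    by rewrite mxE expr0n.
  have := tab; rewrite in_itv /= => /andP[at_ tb].
  apply: (ler0_derive1_nincr _ _ hc) => // s sab; have dhs := dh _ sab.
    exact: ex_derive.
  rewrite derive1E derive_val pmulr_lle0 ?expR_gt0 // subr_le0.
  apply: quadratic_form_bound; apply: AK; exact: subset_itv_oo_cc.
have gt0 : g t = 0.
  by apply/eqP; rewrite eq_le g_ge0 andbT; move: ht0; rewrite pmulr_lle0 ?expR_gt0.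
apply/matrixP => i j; rewrite mxE; apply/eqP; rewrite -sqrf_eq0; apply/eqP.
have rowi : \sum_j X t i j ^+ 2 = 0.
  apply: (psumr_eq0P _ gt0) => // k _; apply: sumr_ge0 => l _; exact: sqr_ge0.
by apply: (psumr_eq0P _ rowi) => // l _; exact: sqr_ge0.
Qed.

(** * The variational equation *)

(** Since [y] is differentiable relative to [[t0, t0 + tau]] it is continuous
    there, even at [t0], where it may jump from the left.  The delayed argument
    is [phi (t - tau)] up to [t = t0 + tau], so continuity of [phi] on the closed
    interval [[t0 - tau, t0]] covers all of [[t0, t0 + tau]]. *)
Lemma variational_coef_continuous {R : realType} {m : nat}
    {f : 'cV[R]_m -> 'cV[R]_m -> 'cV[R]_m} {tau t0 xi : R} {eta : 'cV[R]_m}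
    {phi y : R -> 'cV[R]_m} :
  C1 f -> {within `[t0 - tau, t0], continuous phi} ->
  is_solution f tau t0 xi eta phi y ->
  {within `[t0, t0 + tau], continuous (fun t => F1 f (y t) (phi (t - tau)))}.
Proof.
move=> [_ F1c _] phic [dy _ _]; apply/subspace_continuousP => t tI.
have yt := has_derivative_within_cvg (dy _ tI).
have phit : phi (s - tau) @[s --> within `[t0, t0 + tau] (nbhs t)] --> phi (t - tau).
  have shifted : (s - tau) @[s --> within `[t0, t0 + tau] (nbhs t)] -->
      within `[t0 - tau, t0] (nbhs (t - tau)).
    move=> U; change ((\forall r \near within `[t0 - tau, t0] (nbhs (t - tau)), U r) ->
      \forall s \near within `[t0, t0 + tau] (nbhs t), U (s - tau)).
    rewrite !near_withinE => UI.
    have lim : (s - tau) @[s --> t] --> t - tau.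
      by apply: cvgB; [exact: cvg_id|exact: cvg_cst].
    have near_t : \forall s \near t, `[t0 - tau, t0]%classic (s - tau) -> U (s - tau) :=
      lim _ UI.
    apply: filterS near_t => s Us sI; apply: Us.
    by move: sI; rewrite /= !in_itv /= lerD2r lerBlDr.
  have tauI : `[t0 - tau, t0]%classic (t - tau).
    by move: tI; rewrite /= !in_itv /= lerD2r lerBlDr.
  move/subspace_continuousP : phic => /(_ _ tauI) phitau.
  exact: cvg_comp shifted phitau.
exact: cvg_comp (cvg_pair yt phit) (F1c (y t, phi (t - tau))).
Qed.

Theorem corollary4 (R : realType) (m : nat)
    (f : 'cV[R]_m -> 'cV[R]_m -> 'cV[R]_m) (t0 tau xi : R) (eta : 'cV[R]_m)
    (phi y : R -> 'cV[R]_m)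
    (Phi : R -> R -> 'M[R]_m) (Psi : R -> gen_mx_fun R m)
    (hf : C1 f)
    (hphi : {within `[t0 - tau, t0], continuous phi})
    (htau : 0 < tau)
    (hxi : xi \in `[t0, t0 + tau])
    (hy : is_solution f tau t0 xi eta phi y)
    (hPhi : forall theta, theta \in `[t0, t0 + tau] ->
      is_Phi f tau t0 phi y theta (fun t => Phi t theta))
    (that : R) (hthat : that \in `]xi - tau, t0[)
    (hPsi : is_Psi f tau t0 phi y that (Psi that)) :
  forall t, t \in `[that + tau, t0 + tau] ->
    Psi that t = Phi t (that + tau) *m F2 f (y (that + tau)) (y that).
Proof.
set a := that + tau; set b := t0 + tau; set C := F2 f _ _.
have t0a : t0 <= a.
  move: hxi hthat; rewrite !in_itv /= => /andP[t0xi _] /andP[xit _].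
  by apply: le_trans t0xi _; rewrite -lerBlDr ltW.
have ab : a <= b by move: hthat; rewrite in_itv /= lerD2r => /andP[_ /ltW].
have [dPhi Phia _] : is_Phi f tau t0 phi y a (fun t => Phi t a).
  by apply: hPhi; rewrite in_itv /= t0a.
have [dPsi Psia Psic _] := hPsi.
have subI : `[a, b] `<=` `[t0, b].
  by move=> s; rewrite /= !in_itv /= => /andP[as_ ->]; rewrite (le_trans t0a).
(* Entrywise, [Psi - Phi C] is a linear combination with constant coefficients. *)
have entryE i j : (fun r => (Psi that r - Phi r a *m C) i j) =
    (fun r => Psi that r i j) - \sum_(k < m) (C k j \*: (fun r => Phi r a i k)).
  apply/funext => r; rewrite !mxE /= fct_sumE.
  by congr (_ - _); apply: eq_bigr => k _; rewrite mulrC.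
move=> t tab; apply/subr0_eq.
pose coef s := F1 f (y s) (phi (s - tau)).
apply: (@linear_ode_zero R m m a b coef (fun s => Psi that s - Phi s a *m C)) tab.
- exact: continuous_subspaceW subI (variational_coef_continuous hf hphi hy).
- move=> s sab i j.
  have nI : nbhs s `[a, b]%classic.
    move: sab; rewrite in_itv /= => /andP[as_ sb].
    by apply: filterS (near_in_itvoo _); [exact: subset_itv_oo_cc|rewrite in_itv /= as_].
  have sI : s \in `]a, b] by exact: subset_itv_oo_oc sab.
  have sI0 : s \in `[t0, b] by apply: subI; exact: subset_itv_oo_cc sab.
  have dPsis k := has_derivative_within_is_derive nI
    (has_derivative_within_coord i k (dPsi _ sI)).
  have dPhis k := has_derivative_within_is_derive nI
    (has_derivative_within_sub subI (has_derivative_within_coord i k (dPhi _ sI0))).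
  rewrite entryE; apply: is_derive_eq (is_deriveB (dPsis j)
    (is_derive_sum (fun k => is_deriveZ (C k j) (dPhis k)))) _.
  rewrite mulmxBr mulmxA [RHS]mxE [X in _ = _ + X]mxE [X in _ = _ - X]mxE.
  by congr (_ - _); apply: eq_bigr => k _; rewrite /GRing.scale /= mulrC.
- move=> i j; rewrite entryE; apply: within_continuousB => [s|].
    exact: cvg_comp (Psic s) (@coord_continuous _ _ _ i j _).
  rewrite fct_sumE; apply/subspace_continuousP => s sab.
  apply: cvg_big => [|k _]; first exact: add_continuous.
  have Phis : Phi r a @[r --> within `[a, b] (nbhs s)] --> Phi s a.
    exact: has_derivative_within_cvg
      (has_derivative_within_sub subI (dPhi s (subI s sab))).
  by apply: cvgZr; exact: cvg_comp Phis (@coord_continuous _ _ _ i k _).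
- by rewrite Psia Phia mul1mx subrr.
Qed.
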